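(* Let $(\mathcal U,U,V,W,Z)$ be a complete dual system of metric $f$-structures. Let $\mathscr M$ be a $V$-normed $U$-module and $\mathscr N$ a $Z$-normed $U$-module. Then for every $T\in\mathrm{Hom}(\mathscr M,\mathscr N)$ it holds that $$|Tv|\le|T||v|\quad\text{for every }v\in\mathscr M.$$ Moreover, $(\mathrm{Hom}(\mathscr M,\mathscr N),|\cdot|)$ is a $W$-normed $U$-module and $$\Big|\sum_{n\in\mathbb N}u_n\cdot T_n\Big|=\sum_{n\in\mathbb N}u_n|T_n|\quad\text{for every }(u_n,T_n)_{n\in\mathbb N}\in\mathrm{Adm}(\mathrm{Hom}(\mathscr M,\mathscr N)),$$ where the right-hand side is the glueing in $W$, regarded as a $W$-normed $U$-module. If in addition $\mathscr N$ is a $Z$-Banach $U$-module, then $\mathrm{Hom}(\mathscr M,\mathscr N)$ is a $W$-Banach $U$-module.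
   Context: Riesz spaces and $f$-algebras. $\mathbb R^+=[0,\infty)$. A Riesz space is a real vector space $U$ with a partial order that is a lattice and satisfies $u\le v\Rightarrow u+w\le v+w$ and ($u\ge 0$, $\lambda\in\mathbb R^+$) $\Rightarrow\lambda u\ge 0$; $\vee,\wedge$ denote sup and inf of two elements, $u^{+}=u\vee 0$, $u^-=(-u)\vee 0$, $|u|=u\vee(-u)$, $U^+=\{u\in U:u\ge 0\}$. A Riesz subspace is a linear subspace closed under $\vee,\wedge$; a Riesz subspace $V\subset U$ is solid if $v\in U$, $u\in V$, $|v|\le|u|$ imply $v\in V$. A family is disjoint if $|u|\wedge|v|=0$ for any two different members. Dedekind complete (resp. $\sigma$-complete): every non-empty (resp. countable non-empty) subset bounded above has a supremum and every such subset bounded below has an infimum. An $f$-algebra is a Riesz space with an associative, commutative, $\mathbb R$-bilinear multiplication with unit $\mathbf 1_U$ such that $uv\ge0$ for $u,v\ge 0$, and $(uw)\wedge v=0$ whenever $u\wedge v=0$ and $w\ge 0$. An $f$-subalgebra is a Riesz subspace closed under multiplication and containing $\mathbf 1_U$. $\mathrm{Idem}(U)=\{u\in U:u^2=u\}$. A finite partition of $u\in\mathrm{Idem}(U)$ is a finite disjoint family in $\mathrm{Idem}(U)$ with sum $u$; a countable partition of $u$ is a disjoint family $(u_n)_{n\in\mathbb N}\subset\mathrm{Idem}(U)$ with $\sup_n u_n=u$; $\mathcal P(u)$ is the set of countable partitions of $u$. Simple elements: $\mathcal S(U)=\{\sum_{i=1}^n\lambda_iu_i:\lambda_i\in\mathbb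 R,\ (u_i)_{i=1}^n\text{ a finite partition of }\mathbf 1_U\}$. An order-preserving map is $\sigma$-order-continuous if it preserves existing suprema of non-decreasing sequences and existing infima of non-increasing sequences; it is order-continuous if it preserves existing suprema of upwards directed sets and existing infima of downwards directed sets (products carry the componentwise order). A localisable $f$-algebra is a Dedekind $\sigma$-complete $f$-algebra whose multiplication is $\sigma$-order-continuous on $U^+\times U^+$ and such that every $u\in U^+$ is the supremum of a non-decreasing sequence in $\mathcal S(U)\cap U^+$. Metric notions (products of metric spaces carry the sum distance). A metric Riesz space $(U,\mathsf d_U)$ is a Dedekind $\sigma$-complete Riesz space with a complete distance such that $\mathsf d_U(u,0)=\mathsf d_U(|u|,0)$, $\mathsf d_U(u+w,v+w)=\mathsf d_U(u,v)$, and $\mathsf d_U(u,0)\le\mathsf d_U(v,0)$ whenever $0\le u\le v$. A metric $f$-algebra is a localisable $f$-algebra $U$ with a distance $\mathsf d_U$ such that $(U,\mathsf d_U)$ is a metric Riesz space, the multiplication $U\times U\to U$ is continuous, $\mathcal S(U)$ is dense, and $\mathsf d_U(\varepsilon\mathbf 1_U,0)\to0$ as $\varepsilon\searrow0$. A metric $f$-structure is a triple $(\mathcal U,U,V)$ where $\mathcal U$ is a localisable $f$-algebra; $(U,\mathsf d_U)$ is a metric $f$-algebra that is a solid $f$-subalgebra of $\mathcal U$; $(V,\mathsf d_V)$ is a metric Riesz space that is a solid Riesz subspace of $\mathcal U$; $UV=V$ (where $UV=\{uv:u\in U,v\in V\}$) and the multiplication $U\times V\to V$ is continuous; and for any $(u_n)_n\in\mathcal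 P(\mathbf 1_U)$ and $\varepsilon>0$ there is $\delta>0$ such that, whenever $(v_n)_n\subset V^+$ satisfies $\sum_n\mathsf d_V(u_nv_n,0)\le\delta$, the family $(u_nv_n)_n$ is order-bounded in $V$ and $\mathsf d_V(\sup_nu_nv_n,0)\le\varepsilon$. A dual system of metric $f$-structures is a quintuplet $(\mathcal U,U,V,W,Z)$ such that $(\mathcal U,U,V)$, $(\mathcal U,U,W)$, $(\mathcal U,U,Z)$ are metric $f$-structures, $Z=VW$ and the multiplication $V\times W\to Z$ is continuous. It is complete if in addition $U,V,W,Z$ are Dedekind complete and the multiplication is order-continuous from $U^+\times V^+$ to $V^+$, from $U^+\times W^+$ to $W^+$, from $U^+\times Z^+$ to $Z^+$ and from $V^+\times W^+$ to $Z^+$. Modules. A $V$-normed $U$-module over a metric $f$-structure $(\mathcal U,U,V)$ is a $U$-module $\mathscr M$ (a real vector space via $\lambda v=(\lambda\mathbf 1_U)\cdot v$) with a map $|\cdot|\colon\mathscr M\to V^+$ such that $|v|=0\iff v=0$, $|v+w|\le|v|+|w|$, $|u\cdot v|=|u||v|$, and the glueing property holds: if $(u_n)_n\in\mathcal P(\mathbf 1_U)$ and $(v_n)_n\subset\mathscr M$ are such that $(|u_n\cdot v_n|)_n$ is order-bounded in $V$ (one writes $(u_n,v_n)_n\in\mathrm{Adm}(\mathscr M)$), then there is a (necessarily unique) $v\in\mathscr M$ with $u_n\cdot v=u_n\cdot v_n$ for all $n$, denoted $\sum_{n\in\mathbb N}u_n\cdot v_n$. $\mathscr M$ has the distance $\mathsf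 d_{\mathscr M}(v,w)=\mathsf d_V(|v-w|,0)$; if it is complete, $\mathscr M$ is a $V$-Banach $U$-module. The space $V$ itself is a $V$-Banach $U$-module (with multiplication and absolute value of $\mathcal U$). Homomorphisms. For a dual system $(\mathcal U,U,V,W,Z)$, a $V$-normed $U$-module $\mathscr M$ and a $Z$-normed $U$-module $\mathscr N$, $\mathrm{Hom}(\mathscr M,\mathscr N)$ is the set of $U$-linear maps $T\colon\mathscr M\to\mathscr N$ for which there is $w\in W^+$ with $|Tv|\le w|v|$ for all $v\in\mathscr M$; it is a $U$-module with pointwise operations. When $W$ is Dedekind complete, $|T|:=\inf\{w\in W^+:|Tv|\le w|v|\ \forall v\in\mathscr M\}\in W^+$. *)

(* Defs.v *)
From HB Require Import structures.
From mathcomp Require Import all_boot all_order all_algebra.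
From mathcomp Require Import all_classical all_reals all_analysis.

Set Implicit Arguments.
Unset Strict Implicit.
Unset Printing Implicit Defensive.

Import Order.TTheory GRing.Theory Num.Theory.
Import numFieldNormedType.Exports.

Local Open Scope classical_set_scope.
Local Open Scope ring_scope.

(* Riesz spaces and f-algebras cannot be joins of the library's lattices, rings
   and modules: Hierarchy Builder refuses a structure above two structures whose
   only existing common descendants are the numeric domains.  Binary infima and
   suprema, and the multiplication, are therefore operations of the mixins. *)
HB.mixin Record isRiesz (R : realType) E
    of GRing.Lmodule R E & Num.POrderedZmodule E := {
  rmeet : E -> E -> E ;
  rjoin : E -> E -> E ;
  le_rmeet : forall u v w : E, (w <= rmeet u v) = (w <= u) && (w <= v) ;
  rjoin_le : forall u v w : E, (rjoin u v <= w) = (u <= w) && (v <= w) ;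
  riesz_leD2r : forall u v w : E, u <= v -> u + w <= v + w ;
  riesz_scale_ge0 : forall (a : R) (u : E), 0 <= u -> 0 <= a -> 0 <= a *: u }.

#[short(type="rieszType")]
HB.structure Definition Riesz (R : realType) :=
  {E of GRing.Lmodule R E & Num.POrderedZmodule E & isRiesz R E}.

HB.mixin Record isFAlgebra (R : realType) A of Riesz R A := {
  fone : A ;
  fmul : A -> A -> A ;
  fmulA : associative fmul ;
  fmulC : commutative fmul ;
  fmul1 : left_id fone fmul ;
  fmulDl : left_distributive fmul +%R ;
  fscaleAl : forall (a : R) (u v : A), a *: fmul u v = fmul (a *: u) v ;
  fmul_ge0 : forall u v : A, 0 <= u -> 0 <= v -> 0 <= fmul u v ;
  fmul_meet : forall u v w : A,
    rmeet u v = 0 -> 0 <= w -> rmeet (fmul u w) v = 0 }.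

#[short(type="fAlgType")]
HB.structure Definition FAlgebra (R : realType) :=
  {A of Riesz R A & isFAlgebra R A}.

(* The ring is possibly zero: an f-algebra may be trivial. *)
HB.instance Definition _ (R : realType) (A : fAlgType R) :=
  GRing.Zmodule_isComPzRing.Build (FAlgebra.sort A)
    (@fmulA R A) (@fmulC R A) (@fmul1 R A) (@fmulDl R A).

Section OrderNotions.
Context {d : Order.disp_t} {T : porderType d}.

Definition up_directed (A : set T) :=
  A !=set0 /\
  forall x y, A x -> A y -> exists2 z, A z & (x <= z)%O /\ (y <= z)%O.

Definition down_directed (A : set T) :=
  A !=set0 /\
  forall x y, A x -> A y -> exists2 z, A z & (z <= x)%O /\ (z <= y)%O.

Definition order_bounded {I : Type} (f : I -> T) :=
  has_ubound (range f) /\ has_lbound (range f).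

End OrderNotions.

Definition dedekind_complete {d} (T : porderType d) :=
  (forall A : set T, A !=set0 -> has_ubound A -> supremums A !=set0) /\
  (forall A : set T, A !=set0 -> has_lbound A -> infimums A !=set0).

Definition dedekind_sigma_complete {d} (T : porderType d) :=
  (forall A : set T,
     countable A -> A !=set0 -> has_ubound A -> supremums A !=set0) /\
  (forall A : set T,
     countable A -> A !=set0 -> has_lbound A -> infimums A !=set0).

Section OrderContinuity.
Context {d d' : Order.disp_t} {P : porderType d} {Q : porderType d'}.

Definition sigma_order_continuous (f : P -> Q) :=
  [/\ {homo f : x y / (x <= y)%O},
      (forall (u : nat -> P) s,
         {homo u : m n / (m <= n)%N >-> (m <= n)%O} ->
         supremums (range u) s -> supremums (range (f \o u)) (f s)) &
      (forall (u : nat -> P) s,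
         {homo u : m n / (m <= n)%N >-> (n <= m)%O} ->
         infimums (range u) s -> infimums (range (f \o u)) (f s))].

Definition order_continuous (f : P -> Q) :=
  [/\ {homo f : x y / (x <= y)%O},
      (forall (A : set P) s, up_directed A ->
         supremums A s -> supremums (f @` A) (f s)) &
      (forall (A : set P) s, down_directed A ->
         infimums A s -> infimums (f @` A) (f s))].

End OrderContinuity.

Section RieszNotions.
Context {R : realType} {E : rieszType R}.

Definition absr (u : E) : E := rjoin u (- u).

Definition disjoint_family {I : Type} (u : I -> E) :=
  forall i j, i <> j -> rmeet (absr (u i)) (absr (u j)) = 0.

Definition pos := {x : E | 0 <= x}.
HB.instance Definition _ := SubChoice.on pos.
HB.instance Definition _ :=
  Order.SubChoice_isSubPOrder.Build ring_display E _ ring_display pos.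

Lemma riesz_subr_ge0 (u v : E) : (0 <= v - u) = (u <= v).
Proof.
apply/idP/idP => uv.
  by have := riesz_leD2r _ _ u uv; rewrite add0r subrK.
by have := riesz_leD2r _ _ (- u) uv; rewrite subrr.
Qed.

Lemma riesz_leD (u v u' v' : E) : u <= v -> u' <= v' -> u + u' <= v + v'.
Proof.
move=> uv uv'; apply: (le_trans (riesz_leD2r _ _ u' uv)).
by rewrite ![v + _]addrC; exact: riesz_leD2r.
Qed.

Lemma absr_ge0 (u : E) : 0 <= absr u.
Proof.
have : absr u <= absr u by [].
rewrite {1}/absr rjoin_le => /andP[le1 le2].
have uu : 0 <= absr u *+ 2.
  by rewrite mulr2n -(subrr u); exact: riesz_leD le1 le2.
have h : (0 : R) <= 2%:R^-1 by rewrite invr_ge0 ler0n.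
have := riesz_scale_ge0 _ _ uu h.
have -> : absr u *+ 2 = (2%:R : R) *: absr u by rewrite scaler_nat.
by rewrite scalerA mulVf ?pnatr_eq0// scale1r.
Qed.

End RieszNotions.
Arguments pos {R} E.

Section FAlgebraNotions.
Context {R : realType} (A : fAlgType R).

Definition Idem : set A := [set u | u ^+ 2 = u].

Definition finite_partition n (u : 'I_n -> A) (x : A) :=
  [/\ forall i, Idem (u i), disjoint_family u & \sum_i u i = x].

Definition countable_partition (u : nat -> A) (x : A) :=
  [/\ forall n, Idem (u n), disjoint_family u & supremums (range u) x].

Definition simple : set A :=
  [set x | exists n (a : 'I_n -> R) (u : 'I_n -> A),
     finite_partition u 1 /\ x = \sum_i a i *: u i].

Lemma falg_ler_wpM2l (u v w : A) : 0 <= u -> v <= w -> u * v <= u * w.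
Proof.
move=> u0 vw; rewrite -riesz_subr_ge0 -mulrBr.
by apply: fmul_ge0 => //; rewrite riesz_subr_ge0.
Qed.

Lemma mul_ge0 (u v : pos A) : 0 <= val u * val v.
Proof. exact: fmul_ge0 (valP u) (valP v). Qed.

Definition mulpos (p : pos A *p pos A) : pos A :=
  exist _ (val p.1 * val p.2) (mul_ge0 p.1 p.2).

Record localisable : Prop := Localisable {
  loc_complete : dedekind_sigma_complete A ;
  loc_mul : sigma_order_continuous mulpos ;
  loc_simple : forall u : A, 0 <= u ->
    exists s : nat -> A,
      [/\ forall n, simple (s n) /\ 0 <= s n,
          {homo s : m n / (m <= n)%N >-> m <= n} &
          supremums (range s) u] }.

End FAlgebraNotions.

Section SolidSubspace.
Context {R : realType}.

Record solidSubspace (E : rieszType R) := SolidSubspace {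
  solid_set :> set E ;
  solid_0 : solid_set 0 ;
  solid_lin : forall (a : R) u v,
    solid_set u -> solid_set v -> solid_set (a *: u + v) ;
  solid_meet : forall u v,
    solid_set u -> solid_set v -> solid_set (rmeet u v) ;
  solid_join : forall u v,
    solid_set u -> solid_set v -> solid_set (rjoin u v) ;
  solid_solid : forall u v, solid_set u -> absr v <= absr u -> solid_set v }.

Section SubspaceType.
Context {E : rieszType R} (V : solidSubspace E).

Definition solid_pred : {pred E} := [pred x | x \in solid_set V].

Lemma solid_predP x : reflect (solid_set V x) (x \in solid_pred).
Proof. by apply: (iffP idP); rewrite !inE. Qed.

Lemma solid_submod_closed : submod_closed solid_pred.
Proof.
split; first exact/solid_predP/solid_0.
by move=> a u v /solid_predP Vu /solid_predP Vv; exact/solid_predP/solid_lin.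
Qed.
HB.instance Definition _ :=
  GRing.isSubmodClosed.Build R E solid_pred solid_submod_closed.

Definition subsp : Type := {x : E | x \in solid_pred}.
HB.instance Definition _ := SubChoice.on subsp.
HB.instance Definition _ := [SubChoice_isSubZmodule of subsp by <:].
HB.instance Definition _ := [SubZmodule_isSubLmodule of subsp by <:].
HB.instance Definition _ :=
  Order.SubChoice_isSubPOrder.Build ring_display E _ ring_display subsp.

Lemma subspP (u : subsp) : solid_set V (val u).
Proof. exact/solid_predP/(valP u). Qed.

Definition to_subsp (x : E) (Vx : solid_set V x) : subsp :=
  exist _ x (introT (solid_predP x) Vx).

Definition subsp_meet (u v : subsp) : subsp :=
  to_subsp (solid_meet (subspP u) (subspP v)).
Definition subsp_join (u v : subsp) : subsp :=
  to_subsp (solid_join (subspP u) (subspP v)).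

Lemma subsp_le_meet (u v w : subsp) :
  (w <= subsp_meet u v) = (w <= u) && (w <= v).
Proof. by rewrite !leEsub /= le_rmeet. Qed.

Lemma subsp_join_le (u v w : subsp) :
  (subsp_join u v <= w) = (u <= w) && (v <= w).
Proof. by rewrite !leEsub /= rjoin_le. Qed.

Lemma subsp_leD2r (u v w : subsp) : u <= v -> u + w <= v + w.
Proof. by rewrite !leEsub /= => uv; exact: riesz_leD2r. Qed.

Lemma subsp_scale_ge0 (a : R) (u : subsp) : 0 <= u -> 0 <= a -> 0 <= a *: u.
Proof. by rewrite !leEsub /= => u0 a0; exact: riesz_scale_ge0. Qed.

HB.instance Definition _ := isRiesz.Build R subsp
  subsp_le_meet subsp_join_le subsp_leD2r subsp_scale_ge0.

End SubspaceType.
End SolidSubspace.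

Section SolidFSubalgebra.
Context {R : realType} {A : fAlgType R}.

Record solidFSub := SolidFSub {
  fsub_solid :> solidSubspace A ;
  fsub_1 : solid_set fsub_solid 1 ;
  fsub_mul : forall u v : A,
    solid_set fsub_solid u -> solid_set fsub_solid v ->
    solid_set fsub_solid (u * v) }.

Definition mul_closed (X Y Z : set A) :=
  forall x y, X x -> Y y -> Z (x * y).

Section Product.
Context {V W Z : solidSubspace A} (VWZ : mul_closed V W Z).

Definition subsp_mul (v : subsp V) (w : subsp W) : subsp Z :=
  to_subsp (VWZ (subspP v) (subspP w)).

Lemma subsp_mul_ge0 (v : pos (subsp V)) (w : pos (subsp W)) :
  0 <= subsp_mul (val v) (val w).
Proof.
by case: v w => [v v0] [w w0]; rewrite leEsub; exact: fmul_ge0 v0 w0.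
Qed.

Definition subsp_mulpos (p : pos (subsp V) *p pos (subsp W)) :
    pos (subsp Z) :=
  exist _ (subsp_mul (val p.1) (val p.2)) (subsp_mul_ge0 p.1 p.2).

End Product.

Section FSubalgebraType.
Variable U : solidFSub.

Let fone := to_subsp (fsub_1 U).
Let fmul : subsp U -> subsp U -> subsp U := subsp_mul (@fsub_mul U).

Let fmulA : associative fmul.
Proof. by move=> u v w; apply/val_inj; exact: mulrA. Qed.
Let fmulC : commutative fmul.
Proof. by move=> u v; apply/val_inj; exact: mulrC. Qed.
Let fmul1 : left_id fone fmul.
Proof. by move=> u; apply/val_inj; exact: mul1r. Qed.
Let fmulDl : left_distributive fmul +%R.
Proof. by move=> u v w; apply/val_inj; exact: mulrDl. Qed.
Let fscaleAl (a : R) (u v : subsp U) : a *: fmul u v = fmul (a *: u) v.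
Proof. by apply/val_inj; exact: fscaleAl. Qed.
Let fmul_ge0 (u v : subsp U) : 0 <= u -> 0 <= v -> 0 <= fmul u v.
Proof. by rewrite !leEsub => u0 v0; exact: fmul_ge0 u0 v0. Qed.
Let fmul_meet (u v w : subsp U) :
  rmeet u v = 0 -> 0 <= w -> rmeet (fmul u w) v = 0.
Proof.
move=> /(congr1 val) uv; rewrite leEsub => w0; apply/val_inj.
exact: fmul_meet uv w0.
Qed.

HB.instance Definition _ := isFAlgebra.Build R (subsp U)
  fmulA fmulC fmul1 fmulDl fscaleAl fmul_ge0 fmul_meet.
HB.instance Definition _ :=
  GRing.ComPzRing.copy (subsp U) (FAlgebra.sort (subsp U)).

Lemma subsp_valM (u v : subsp U) : val (u * v) = (val u : A) * val v.
Proof. by []. Qed.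

Lemma subsp_val1 : val (1 : subsp U) = 1 :> A.
Proof. by []. Qed.

End FSubalgebraType.
End SolidFSubalgebra.
Arguments solidFSub {R} A.

Section MetricNotions.
Context {R : realType}.

Record is_distance {E : Type} (dist : E -> E -> R) : Prop := IsDistance {
  dist_eq0 : forall x y, dist x y = 0 <-> x = y ;
  dist_sym : forall x y, dist x y = dist y x ;
  dist_triangle : forall x y z, dist x z <= dist x y + dist y z }.

Definition complete_dist {E : Type} (dist : E -> E -> R) :=
  forall x : nat -> E,
    (forall e : R, 0 < e -> \forall m & n \near \oo, dist (x m) (x n) < e) ->
    exists l, dist (x n) l @[n --> \oo] --> (0 : R).

Definition continuous2 {E F G : Type} (dE : E -> E -> R) (dF : F -> F -> R)
    (dG : G -> G -> R) (f : E -> F -> G) :=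
  forall x y (e : R), 0 < e -> exists2 del : R, 0 < del &
    forall x' y', dE x x' + dF y y' < del -> dG (f x y) (f x' y') < e.

Record metric_riesz (E : rieszType R) (dist : E -> E -> R) : Prop :=
  MetricRiesz {
  mr_sigma_complete : dedekind_sigma_complete E ;
  mr_distance : is_distance dist ;
  mr_complete : complete_dist dist ;
  mr_abs : forall u, dist u 0 = dist (absr u) 0 ;
  mr_translation : forall u v w, dist (u + w) (v + w) = dist u v ;
  mr_monotone : forall u v : E, 0 <= u -> u <= v -> dist u 0 <= dist v 0 }.

Record metric_falgebra (A : fAlgType R) (dist : A -> A -> R) : Prop :=
  MetricFAlgebra {
  mfa_localisable : localisable A ;
  mfa_riesz : metric_riesz dist ;
  mfa_mul : continuous2 dist dist dist (fun u v => u * v) ;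
  mfa_dense : forall (u : A) (e : R), 0 < e ->
    exists2 s, simple s & dist u s < e ;
  mfa_unit : dist ((e : R) *: (1 : A)) 0 @[e --> (0 : R)^'+] --> (0 : R) }.

End MetricNotions.

Section MetricFStructures.
Context {R : realType} {A : fAlgType R}.

Record metricSolid := MetricSolid {
  ms_solid :> solidSubspace A ;
  ms_dist : subsp ms_solid -> subsp ms_solid -> R ;
  ms_metric : metric_riesz ms_dist }.

Record metricSolidFSub := MetricSolidFSub {
  mf_fsub :> solidFSub A ;
  mf_dist : subsp mf_fsub -> subsp mf_fsub -> R ;
  mf_metric : metric_falgebra mf_dist }.

Lemma mul_eq_closed (X Y Z : set A) :
  [set x * y | x in X & y in Y] = Z -> mul_closed X Y Z.
Proof. by move=> <- x y Xx Yy; exists x => //; exists y. Qed.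

Record metric_fstructure (U : metricSolidFSub) (V : metricSolid) : Prop :=
  MetricFStructure {
  mfs_localisable : localisable A ;
  mfs_mul : [set u * v | u in solid_set U & v in solid_set V] = solid_set V ;
  mfs_continuous : continuous2 (@mf_dist U) (@ms_dist V) (@ms_dist V)
    (subsp_mul (mul_eq_closed mfs_mul)) ;
  mfs_sup : forall (u : nat -> subsp U) (e : R),
    countable_partition u 1 -> 0 < e -> exists2 del : R, 0 < del &
    forall v : nat -> subsp V, (forall n, 0 <= v n) ->
      let uv n := subsp_mul (mul_eq_closed mfs_mul) (u n) (v n) in
      (\sum_(0 <= n <oo) (ms_dist (uv n) 0)%:E <= del%:E)%E ->
      order_bounded uv /\
      exists2 s, supremums (range uv) s & ms_dist s 0 <= e }.

Definition mfs_closed U V (S : metric_fstructure U V) :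
  mul_closed U V V := mul_eq_closed (mfs_mul S).

Record dual_system (U : metricSolidFSub) (V W Z : metricSolid) : Prop :=
  DualSystem {
  ds_V : metric_fstructure U V ;
  ds_W : metric_fstructure U W ;
  ds_Z : metric_fstructure U Z ;
  ds_mul : [set v * w | v in solid_set V & w in solid_set W] = solid_set Z ;
  ds_continuous : continuous2 (@ms_dist V) (@ms_dist W) (@ms_dist Z)
    (subsp_mul (mul_eq_closed ds_mul)) }.

Record complete_dual_system (U : metricSolidFSub) (V W Z : metricSolid) :
    Prop := CompleteDualSystem {
  cds_dual :> dual_system U V W Z ;
  cds_U : dedekind_complete (subsp U) ;
  cds_V : dedekind_complete (subsp V) ;
  cds_W : dedekind_complete (subsp W) ;
  cds_Z : dedekind_complete (subsp Z) ;
  cds_UV : order_continuous (subsp_mulpos (mfs_closed (ds_V cds_dual))) ;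
  cds_UW : order_continuous (subsp_mulpos (mfs_closed (ds_W cds_dual))) ;
  cds_UZ : order_continuous (subsp_mulpos (mfs_closed (ds_Z cds_dual))) ;
  cds_VW : order_continuous (subsp_mulpos (mul_eq_closed (ds_mul cds_dual))) }.

End MetricFStructures.
Arguments metricSolid {R} A.
Arguments metricSolidFSub {R} A.

Section NormedModules.
Context {R : realType} {A : fAlgType R}.

Section Glueing.
Context {U : solidFSub A} {M : lmodType (subsp U)}.

Definition is_glueing (u : nat -> subsp U) (v : nat -> M) (x : M) :=
  forall n, u n *: x = u n *: v n.

(* Junk value 0 if no glueing exists; glueings are unique in normed modules. *)
Definition module_glue (u : nat -> subsp U) (v : nat -> M) : M :=
  xget 0 [set x | is_glueing u v x].

Definition Adm {V : solidSubspace A} (nrm : M -> subsp V)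
    (u : nat -> subsp U) (v : nat -> M) :=
  countable_partition u 1 /\ order_bounded (fun n => nrm (u n *: v n)).

Record is_normed_module {V : solidSubspace A} (nrm : M -> subsp V) : Prop :=
  IsNormedModule {
  nm_ge0 : forall v, 0 <= nrm v ;
  nm_eq0 : forall v, nrm v = 0 <-> v = 0 ;
  nm_triangle : forall v w, nrm (v + w) <= nrm v + nrm w ;
  nm_scale : forall u v,
    val (nrm (u *: v)) = (val (absr u) : A) * val (nrm v) ;
  nm_glueing : forall u v, Adm nrm u v -> exists x, is_glueing u v x }.

Record is_banach_module {V : metricSolid A} (nrm : M -> subsp V) : Prop :=
  IsBanachModule {
  bm_normed : is_normed_module nrm ;
  bm_complete : complete_dist (fun v w => ms_dist (nrm (v - w)) 0) }.

End Glueing.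

Record normedModule (U : solidFSub A) (V : solidSubspace A) := NormedModule {
  nm_mod :> lmodType (subsp U) ;
  nm_norm : nm_mod -> subsp V ;
  nm_normed : is_normed_module nm_norm }.

End NormedModules.
Arguments nm_norm {R A U V n} v.

Section AsModule.
Context {R : realType} {A : fAlgType R} {U : solidFSub A} {V : solidSubspace A}.
Variable UV : mul_closed U V V.

(* V carries its R-module structure as subsp V; as_module is V as a U-module. *)
Definition as_module of mul_closed U V V : Type := subsp V.
Local Notation MV := (as_module UV).
HB.instance Definition _ := GRing.Zmodule.copy MV (subsp V).

Let scale (u : subsp U) (v : MV) : MV := subsp_mul UV u v.
Let scaleA u v w : scale u (scale v w) = scale (u * v) w.
Proof. by apply/val_inj; exact: mulrA. Qed.
Let scale1 : left_id 1 scale.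
Proof. by move=> v; apply/val_inj; exact: mul1r. Qed.
Let scaleDr : right_distributive scale +%R.
Proof. by move=> u v w; apply/val_inj; exact: mulrDr. Qed.
Let scaleDl v : {morph scale^~ v : u w / u + w}.
Proof. by move=> u w; apply/val_inj; exact: mulrDl. Qed.

HB.instance Definition _ := GRing.Zmodule_isLmodule.Build (subsp U) MV
  scaleA scale1 scaleDr scaleDl.

End AsModule.

Section HomModule.
Context {R : realType} {A : fAlgType R} {U : metricSolidFSub A}.
Context {V W Z : metricSolid A} (D : dual_system U V W Z).
Context (M : normedModule U V) (N : normedModule U Z).

Definition hom_bound (T : M -> N) (w : subsp W) :=
  0 <= w /\
  forall v, val (nm_norm (T v)) <= (val w : A) * val (nm_norm v).

(* Membership does not involve D; its being a U-module does. *)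
Definition hom_pred of dual_system U V W Z : {pred M -> N} :=
  [pred T : M -> N | `[< linear T /\ exists w, hom_bound T w >] ].

Lemma hom_predP (T : M -> N) :
  reflect (linear T /\ exists w, hom_bound T w) (T \in hom_pred D).
Proof. exact: asboolP. Qed.

Lemma hom_submod_closed : submod_closed (hom_pred D).
Proof.
split=> [|a T S /hom_predP[linT [w [w0 Tw]]] /hom_predP[linS [t [t0 St]]]].
  apply/hom_predP; split=> [b u v|].
    by rewrite /GRing.zero /= scaler0 addr0.
  exists 0; split=> // v; rewrite [leRHS]mul0r.
  by have [_ ->] := nm_eq0 (nm_normed N) 0.
apply/hom_predP; split=> [b u v|].
  have E x : (a *: T + S) x = a *: T x + S x by [].
  rewrite !E linT linS !scalerDr !scalerA [a * b]mulrC -!addrA.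
  by congr (_ + _); rewrite addrCA.
exists (subsp_mul (mfs_closed (ds_W D)) (absr a) w + t); split.
  rewrite -[0]addr0; apply: riesz_leD => //.
  by rewrite leEsub; apply: fmul_ge0; [exact: (absr_ge0 a) | exact: w0].
move=> v; have -> : (a *: T + S) v = a *: T v + S v by [].
have := nm_triangle (nm_normed N) (a *: T v) (S v); rewrite leEsub => NTS.
apply: (le_trans NTS).
rewrite [leRHS]mulrDl; apply: riesz_leD; last exact: St.
rewrite (nm_scale (nm_normed N)) -mulrA.
by apply: falg_ler_wpM2l (Tw v); exact: (absr_ge0 a).
Qed.
HB.instance Definition _ :=
  GRing.isSubmodClosed.Build (subsp U) (M -> N) (hom_pred D) hom_submod_closed.

Definition moduleHom : Type := {T : M -> N | T \in hom_pred D}.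
HB.instance Definition _ := SubChoice.on moduleHom.
HB.instance Definition _ := [SubChoice_isSubZmodule of moduleHom by <:].
HB.instance Definition _ := [SubZmodule_isSubLmodule of moduleHom by <:].

Definition hom_norm (T : moduleHom) : subsp W :=
  infimum 0 [set w | hom_bound (val T) w].

End HomModule.
Arguments moduleHom {R A U V W Z} D M N.
Arguments hom_norm {R A U V W Z D M N} T.

(* Main.v *)
Require Import Defs.
From HB Require Import structures.
From mathcomp Require Import all_boot all_order all_algebra.
From mathcomp Require Import all_classical all_reals all_analysis.
From mathcomp Require Import ring.

Set Implicit Arguments.
Unset Strict Implicit.
Unset Printing Implicit Defensive.

Import Order.TTheory GRing.Theory Num.Theory.
Import numFieldNormedType.Exports.

Local Open Scope classical_set_scope.
Local Open Scope ring_scope.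

(** Call [w >= 0] in [W] a bound of [T] when [|T v| <= w |v|] for all [v], so
    that [|T|] is the infimum of the bounds of [T].

    Multiplication by a positive element of an f-algebra commutes with binary
    infima ([rmeetMr]), so the bounds of [T] are closed under infima.  They
    form a downward directed set, and order continuity of the product
    [V x W -> Z] lets the inequality pass to the infimum: [|T|] is itself a
    bound, the least one ([hom_bound_norm]).  Definiteness and the triangle
    inequality follow at once, as does [|u T| <= |u| |T|].

    The reverse inequality [|u| |T| <= |u T|] uses leastness
    ([bounded_mul_hom_norm_le]).  If [0 <= s <= |u|] and [s <= K 1] then with
    [c = s / K] the identity [1 = (1 - c) + c] shows that
    [(1 - c) |T| + |u T| / K] bounds [T]; hence it dominates [|T|], which says
    [s |T| <= |u T|].  Simple elements are such [s], and [|u|] is the supremum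
    of a non-decreasing sequence of them.

    Glueing is done pointwise: [T v] is the glueing of [(T_n v)_n] in the
    target.  Everything about it is checked after multiplication by each
    [u_n], because inequalities in the ambient f-algebra are local with respect
    to a countable partition of unity ([partition_le]).  Since [|.|] commutes
    with scalars, the norm of a glueing of [(T_n)_n] is a glueing of
    [(|T_n|)_n], and glueings are unique.

    For completeness, let [(T_n)_n] be Cauchy.  It converges pointwise to some
    linear [F].  For fixed [n] the sequence [m |-> |T_m - T_n|] is Cauchy in
    [W], with a limit [w_n], and [|F v - T_n v| <= w_n |v|] because the order
    is closed ([norm_sub_limit_le]).  So [F] is a homomorphism,
    [|F - T_n| <= w_n], and the distance from [w_n] to [0] is a limit of
    distances between [T_m] and [T_n], hence small. *)

(** * Riesz spaces *)

Section RieszTheory.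
Context {R : realType} {E : rieszType R}.
Implicit Types u v w x y : E.

Lemma riesz_lerB u v w : (u - v <= w) = (u <= w + v).
Proof.
apply/idP/idP => h.
  by have := riesz_leD2r _ _ v h; rewrite subrK.
by have := riesz_leD2r _ _ (- v) h; rewrite addrK.
Qed.

Lemma riesz_addr_ge0 u v : 0 <= u -> 0 <= v -> 0 <= u + v.
Proof. by move=> u0 v0; rewrite -[0]addr0; exact: riesz_leD. Qed.

Lemma riesz_ler_sum (I : finType) (f g : I -> E) :
  (forall i, f i <= g i) -> \sum_i f i <= \sum_i g i.
Proof.
move=> fg; elim/big_rec2 : _ => // i x y _ xy.
exact: riesz_leD.
Qed.

Lemma riesz_ler_wpZ2l (a : R) u v : 0 <= a -> u <= v -> a *: u <= a *: v.
Proof.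
move=> a0 uv; rewrite -riesz_subr_ge0 -scalerBr.
by apply: riesz_scale_ge0 => //; rewrite riesz_subr_ge0.
Qed.

Lemma riesz_ler_wpZ2r (a b : R) u : 0 <= u -> a <= b -> a *: u <= b *: u.
Proof.
move=> u0 ab; rewrite -riesz_subr_ge0 -scalerBl.
by apply: riesz_scale_ge0 => //; rewrite subr_ge0.
Qed.

Lemma rmeet_lel u v : rmeet u v <= u.
Proof. by have := le_rmeet u v (rmeet u v); rewrite lexx => /esym/andP[]. Qed.

Lemma rmeet_ler u v : rmeet u v <= v.
Proof. by have := le_rmeet u v (rmeet u v); rewrite lexx => /esym/andP[]. Qed.

Lemma rjoin_gel u v : u <= rjoin u v.
Proof. by have := rjoin_le u v (rjoin u v); rewrite lexx => /esym/andP[]. Qed.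

Lemma rjoin_ger u v : v <= rjoin u v.
Proof. by have := rjoin_le u v (rjoin u v); rewrite lexx => /esym/andP[]. Qed.

Lemma rmeetC : commutative (@rmeet R E).
Proof.
by move=> u v; apply/le_anti/andP; split;
  rewrite le_rmeet rmeet_lel rmeet_ler.
Qed.

Lemma rmeetDr u v w : rmeet (u + w) (v + w) = rmeet u v + w.
Proof.
apply/le_anti/andP; split.
  by rewrite -riesz_lerB le_rmeet !riesz_lerB rmeet_lel rmeet_ler.
by rewrite le_rmeet !riesz_leD2r ?rmeet_lel ?rmeet_ler.
Qed.

Lemma absr_le u w : (absr u <= w) = (u <= w) && (- u <= w).
Proof. exact: rjoin_le. Qed.

Lemma ler_absr u : u <= absr u.
Proof. exact: rjoin_gel. Qed.

Lemma absrN u : absr (- u) = absr u.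
Proof.
by apply/le_anti/andP; split; rewrite /absr opprK rjoin_le rjoin_gel rjoin_ger.
Qed.

Lemma ger0_absr u : 0 <= u -> absr u = u.
Proof.
move=> u0; apply/le_anti; rewrite ler_absr absr_le lexx /= andbT.
by apply: (le_trans _ u0); rewrite -sub0r riesz_lerB add0r.
Qed.

End RieszTheory.

(** * f-algebras *)

Section FAlgebraTheory.
Context {R : realType} {A : fAlgType R}.
Implicit Types u v w x y : A.

Lemma falg_ler_wpM2r u v w : 0 <= u -> v <= w -> v * u <= w * u.
Proof. by move=> u0 vw; rewrite ![_ * u]mulrC; exact: falg_ler_wpM2l. Qed.

Lemma falg_scalerAl (a : R) u v : a *: (u * v) = (a *: u) * v.
Proof. exact: fscaleAl. Qed.

(** Multiplication by [w >= 0] is a lattice homomorphism: translating by the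
    infimum reduces the claim to disjoint [u] and [v], where it is the f-algebra
    axiom applied to each factor in turn. *)
Lemma rmeetMr u v w : 0 <= w -> rmeet (u * w) (v * w) = rmeet u v * w.
Proof.
move=> w0; set m := rmeet u v.
have uv0 : rmeet (u - m) (v - m) = 0 by rewrite rmeetDr subrr.
have h := fmul_meet _ _ w uv0 w0; rewrite rmeetC in h.
have := fmul_meet _ _ w h w0; rewrite rmeetC.
have mulE a b : fmul a b = a * b :> A by [].
rewrite !mulE !mulrBl rmeetDr => /eqP.
by rewrite addr_eq0 opprK => /eqP.
Qed.

Lemma rmeet_eq0_mul u v : 0 <= u -> 0 <= v -> rmeet u v = 0 -> u * v = 0.
Proof.
move=> u0 v0 uv; have := fmul_meet _ _ _ uv v0.
rewrite rmeetC => /fmul_meet/(_ u0).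
have mulE a b : fmul a b = a * b :> A by [].
rewrite !mulE [v * u]mulrC => <-.
by apply/le_anti; rewrite le_rmeet lexx rmeet_lel.
Qed.

(** Write [u = p - n] with [p] and [n] the positive and negative parts: they
    are disjoint, so [p n = 0] and [u ^ 2 = p ^ 2 + n ^ 2]. *)
Lemma sqr_ge0r u : 0 <= u ^+ 2.
Proof.
pose p := rjoin u 0; pose n := p - u.
have n0 : 0 <= n by rewrite riesz_subr_ge0 rjoin_gel.
have p0 : 0 <= p by rewrite rjoin_ger.
have pn : rmeet p n = 0.
  apply/le_anti; rewrite le_rmeet p0 n0 !andbT.
  set m := rmeet p n.
  have : p <= p - m.
    rewrite {1}/p rjoin_le riesz_subr_ge0 rmeet_lel andbT.
    by rewrite -riesz_subr_ge0 addrAC riesz_subr_ge0 rmeet_ler.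
  by rewrite -riesz_subr_ge0 addrAC subrr add0r -sub0r riesz_subr_ge0.
have un : u = p - n by rewrite opprB addrC subrK.
rewrite un sqrrB (rmeet_eq0_mul p0 n0 pn) mul0rn subr0.
by apply: riesz_addr_ge0; rewrite expr2; exact: fmul_ge0.
Qed.

Lemma Idem_ge0 u : Idem u -> 0 <= u.
Proof. by move=> <-; exact: sqr_ge0r. Qed.

Lemma falg_ler01 : 0 <= 1 :> A.
Proof. by rewrite -[1](expr1n _ 2) sqr_ge0r. Qed.

Lemma simple_le_scale1 u : simple u -> exists2 K : R, 0 < K & u <= K *: (1 : A).
Proof.
move=> [n [a [e [[eI _ e1] ->]]]]; pose K := 1 + \sum_i `|a i|.
have K0 : 0 < K by rewrite ltr_pwDl// sumr_ge0.
exists K => //; rewrite -e1 scaler_sumr; apply: riesz_ler_sum => i.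
apply: riesz_ler_wpZ2r; first exact: Idem_ge0.
rewrite (le_trans (ler_norm _))// /K (bigD1 i)//= addrCA lerDl.
by rewrite addr_ge0// sumr_ge0.
Qed.

(** Sequential order continuity of the product, in the only form needed: along
    the pairs [(s n, t)], against an upper bound [w]. *)
Lemma mul_le_of_sup (s : nat -> A) u t w : localisable A ->
  (forall n, 0 <= s n) -> {homo s : m n / (m <= n)%N >-> m <= n} ->
  supremums (range s) u -> 0 <= t -> (forall n, s n * t <= w) -> u * t <= w.
Proof.
move=> [_ [_ mulsup _] _] s0 sn [su us] t0 stw.
have u0 : 0 <= u by apply: le_trans (s0 0%N) _; apply: su; exists 0%N.
have w0 : 0 <= w by apply: le_trans (stw 0%N); exact: fmul_ge0.
pose P x (x0 : 0 <= x) : pos A := exist _ x x0.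
pose q n : pos A *p pos A := (P _ (s0 n), P _ t0).
have qu : supremums (range q) (P _ u0, P _ t0).
  split=> [_ [n _ <-]|[a b] qab].
    by rewrite leEprod /= lexx andbT leEsub /=; apply: su; exists n.
  have qn n : s n <= val a /\ t <= val b.
    have := qab (q n) (ex_intro2 _ _ n I erefl).
    by rewrite leEprod !leEsub => /andP[].
  rewrite leEprod !leEsub /=; have [_ ->] := qn 0%N; rewrite andbT.
  by apply: us => _ [n _ <-]; have [] := qn n.
have qn : {homo q : m n / (m <= n)%N >-> (m <= n)%O}.
  by move=> m n mn; rewrite leEprod lexx andbT leEsub /=; exact: sn.
have [_ /(_ (P _ w0))] := mulsup q _ qn qu.
rewrite leEsub /=; apply => _ [n _ <-].
by rewrite leEsub; exact: stw.
Qed.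

End FAlgebraTheory.

(** * Partitions of unity and normed modules *)

Section Localisation.
Context {R : realType} {A : fAlgType R} {U : solidFSub A}.

Lemma partition_ge0 (u : nat -> subsp U) n :
  countable_partition u 1 -> 0 <= (val (u n) : A).
Proof. by move=> [uI _ _]; have := Idem_ge0 (uI n); rewrite leEsub. Qed.

(** Inequalities are local.  With [z = a - a /\ b] every [u_n z] vanishes, and
    so does every [u_n y] for the truncation [y = z /\ 1].  The truncation lies
    in [U], where [1] is the supremum of the [u_n]: from [u_n <= 1 - y] one gets
    [1 <= 1 - y], so [z] is disjoint from [1], hence from itself. *)
Lemma partition_le (u : nat -> subsp U) (a b : A) :
  countable_partition u 1 ->
  (forall n, val (u n) * a <= val (u n) * b) -> a <= b.
Proof.
move=> pu ab; have u0 n := partition_ge0 n pu.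
have [_ _ [_ us]] := pu.
pose m := rmeet a b; pose z := a - m; pose y := rmeet z 1.
have z0 : 0 <= z by rewrite riesz_subr_ge0 rmeet_lel.
have uz n : val (u n) * z = 0.
  rewrite mulrBr [_ * m]mulrC -rmeetMr// ![_ * val (u n)]mulrC.
  apply/eqP; rewrite subr_eq0; apply/eqP/le_anti.
  by rewrite rmeet_lel le_rmeet lexx ab.
have y0 : 0 <= y by rewrite le_rmeet z0 falg_ler01.
have Uy : solid_set U y.
  apply: (solid_solid (fsub_1 U)); rewrite !ger0_absr// ?rmeet_ler//.
  exact: falg_ler01.
(* Since y (1 - u_n) <= 1 - u_n and y u_n = 0. *)
have uy n : val (u n) <= 1 - y.
  rewrite -riesz_subr_ge0 addrAC riesz_subr_ge0.
  have uy0 : val (u n) * y <= 0 by rewrite -(uz n) falg_ler_wpM2l ?rmeet_lel.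
  have [_ _ [/(_ (u n)) un1 _]] := pu.
  have {}un1 : 0 <= 1 - val (u n).
    rewrite riesz_subr_ge0.
    by have := un1 (ex_intro2 _ _ n I erefl); rewrite leEsub.
  have yu : y * (1 - val (u n)) <= 1 * (1 - val (u n)).
    by apply: falg_ler_wpM2r => //; exact: rmeet_ler.
  rewrite mul1r mulrBr mulr1 in yu.
  apply: le_trans yu.
  by rewrite -riesz_subr_ge0 addrAC subrr sub0r -sub0r riesz_subr_ge0 mulrC.
have /us : ubound (range u) (1 - to_subsp Uy).
  by move=> _ [n _ <-]; rewrite leEsub; exact: uy.
rewrite -riesz_subr_ge0 addrAC subrr sub0r -sub0r riesz_subr_ge0 leEsub => y'.
have yE : rmeet (1 : A) z = 0.
  by rewrite rmeetC; apply/le_anti; rewrite y0 andbT; exact: y'.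
have := fmul_meet _ _ _ yE z0; rewrite fmul1 => zz.
have /eqP : z = 0.
  by apply/le_anti; rewrite z0 andbT -zz le_rmeet lexx.
by rewrite subr_eq0 => /eqP ->; exact: rmeet_ler.
Qed.

End Localisation.

Section NormedModuleTheory.
Context {R : realType} {A : fAlgType R} {U : solidFSub A}.
Context {V : solidSubspace A} {M : lmodType (subsp U)} {nrm : M -> subsp V}.
Context (nrmP : is_normed_module nrm).

Lemma nm_norm0 : nrm 0 = 0.
Proof. exact/(nm_eq0 nrmP). Qed.

Lemma nm_normN x : nrm (- x) = nrm x.
Proof.
apply/val_inj; rewrite -scaleN1r (nm_scale nrmP) absrN ger0_absr ?mul1r//.
exact: falg_ler01.
Qed.

Lemma nm_normB x y : nrm (x - y) = nrm (y - x).
Proof. by rewrite -nm_normN opprB. Qed.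

Lemma nm_normB_triangle x y z : nrm (x - z) <= nrm (x - y) + nrm (y - z).
Proof. by have := nm_triangle nrmP (x - y) (y - z); rewrite addrA subrK. Qed.

(** The reverse triangle inequality, through which norms of a Cauchy sequence
    are again Cauchy. *)
Lemma nm_absB x y : absr (nrm x - nrm y) <= nrm (x - y).
Proof.
rewrite absr_le opprB !riesz_lerB; apply/andP; split.
  by have := nm_triangle nrmP (x - y) y; rewrite subrK.
by rewrite nm_normB; have := nm_triangle nrmP (y - x) x; rewrite subrK.
Qed.

Lemma nm_partition_le (u : nat -> subsp U) (a : A) x :
  countable_partition u 1 ->
  (forall n, val (nrm (u n *: x)) <= val (u n) * a) -> val (nrm x) <= a.
Proof.
move=> pu h; apply: (partition_le pu) => n; apply: le_trans (h n).
by rewrite (nm_scale nrmP) ger0_absr// leEsub; exact: partition_ge0.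
Qed.

Lemma glueing_unique (u : nat -> subsp U) (v : nat -> M) x y :
  countable_partition u 1 -> is_glueing u v x -> is_glueing u v y -> x = y.
Proof.
move=> pu ux uy; apply/eqP; rewrite -subr_eq0; apply/eqP/(nm_eq0 nrmP).
apply/le_anti; rewrite (nm_ge0 nrmP) andbT leEsub.
apply: (nm_partition_le pu) => n.
by rewrite scalerBr ux uy subrr nm_norm0 mulr0.
Qed.

Lemma module_glueP (u : nat -> subsp U) (v : nat -> M) :
  Adm nrm u v -> is_glueing u v (module_glue u v).
Proof. by move=> /(nm_glueing nrmP) ex; exact: (xgetPex 0 ex). Qed.

End NormedModuleTheory.

(** * Translation-invariant monotone distances *)

Section MetricRiesz.
Context {R : realType} {E : rieszType R} {dist : E -> E -> R}.
Context (dP : metric_riesz dist).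

Lemma mr_dist_ge0 x y : 0 <= dist x y.
Proof.
have [eq0 sym tri] := mr_distance dP.
have xx : dist x x = 0 by exact/eq0.
by have := tri x y x; rewrite xx [dist y x]sym -mulr2n pmulrn_lge0.
Qed.

Lemma mr_distB x y : dist x y = dist (x - y) 0.
Proof. by rewrite -(mr_translation dP x y (- y)) subrr. Qed.

Lemma mr_dist0D x y : dist (x + y) 0 <= dist x 0 + dist y 0.
Proof.
have [_ _ tri] := mr_distance dP.
by apply: le_trans (tri _ y _) _; rewrite mr_distB addrK.
Qed.

Lemma mr_dist_le x y : absr x <= y -> dist x 0 <= dist y 0.
Proof.
by move=> xy; rewrite (mr_abs dP); apply: (mr_monotone dP) => //; exact: absr_ge0.
Qed.

(** The order is closed: an element with arbitrarily small upper bounds has a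
    positive part of arbitrarily small distance to [0].  The limit arguments on
    homomorphisms all reduce to this. *)
Lemma mr_le0 x :
  (forall e : R, 0 < e -> exists2 a, x <= a & dist a 0 < e) -> x <= 0.
Proof.
move=> small; have [eq0 _ _] := mr_distance dP.
suff /eq0 <- : dist (rjoin x 0) 0 = 0 by exact: rjoin_gel.
apply/le_anti/andP; split; last exact: mr_dist_ge0.
apply/ler_addgt0Pr => e e0; rewrite add0r.
have [a xa /ltW] := small e e0; apply: le_trans.
rewrite [leRHS](mr_abs dP); apply: (mr_monotone dP); first exact: rjoin_ger.
by rewrite rjoin_le absr_ge0 andbT (le_trans xa)// ler_absr.
Qed.

End MetricRiesz.

Section Sequences.
Context {R : realType}.

Lemma near2_ooP (P : nat -> nat -> Prop) :
  (\forall m & n \near \oo, P m n) <->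
  exists K, forall m n, (K <= m)%N -> (K <= n)%N -> P m n.
Proof.
split=> [[[B C] /= [[K _ KB] [L _ LC]] BC]|[K KP]].
  exists (maxn K L) => m n; rewrite !geq_max => /andP[Km _] /andP[_ Ln].
  by apply: (BC (m, n)); split; [exact: KB|exact: LC].
exists ([set m | (K <= m)%N], [set n | (K <= n)%N]) => /=.
  by split; exists K.
by move=> [m n] /= [] /KP; exact.
Qed.

Lemma cvg0_ooP (f : nat -> R) : (forall n, 0 <= f n) ->
  (f n @[n --> \oo] --> (0 : R)) <->
  forall e : R, 0 < e -> exists K, forall n, (K <= n)%N -> f n < e.
Proof.
move=> f0; split=> [/cvgrPdist_lt h e e0|h].
  have [K _ KP] := h e e0; exists K => n /KP /=.
  by rewrite sub0r normrN ger0_norm.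
apply/cvgrPdist_lt => e e0; have [K KP] := h e e0.
by exists K => // n /KP; rewrite /= sub0r normrN ger0_norm.
Qed.

End Sequences.

(** * Order and metric properties of the product *)

Section ContinuousProduct.
Context {R : realType} {A : fAlgType R} {X Y Z : solidSubspace A}.
Context (XYZ : mul_closed X Y Z).

Lemma continuous2_mul0 (dX : subsp X -> subsp X -> R) dY dZ x (e : R) :
  metric_riesz dX -> metric_riesz dY ->
  continuous2 dX dY dZ (subsp_mul XYZ) -> metric_riesz dZ -> 0 < e ->
  exists2 del : R, 0 < del &
    forall y, dY y 0 < del -> dZ (subsp_mul XYZ x y) 0 < e.
Proof.
move=> [_ [dX0 _ _] _ _ _ _] [_ [_ dYs _] _ _ _ _] cont [_ [_ dZs _] _ _ _ _] e0.
have [del del0 small] := cont x 0 e e0; exists del => // y ydel.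
have xx : dX x x = 0 by exact/dX0.
have := small x y; rewrite xx add0r dYs dZs => /(_ ydel).
by have -> : subsp_mul XYZ x 0 = 0 by apply/val_inj; exact: mulr0.
Qed.

End ContinuousProduct.

(** * The norm of a homomorphism *)

Section HomNorm.
Context {R : realType} {A : fAlgType R} {U : metricSolidFSub A}.
Context {V W Z : metricSolid A} (D : complete_dual_system U V W Z).
Context {M : normedModule U V} {N : normedModule U Z}.
Local Notation Hom := (moduleHom D M N).
Implicit Types (T S : Hom) (v : M).

Let normN := nm_normed N.

Lemma norm_ge0 {X : solidSubspace A} (L : normedModule U X) (x : L) :
  0 <= val (nm_norm x) :> A.
Proof. by have := nm_ge0 (nm_normed L) x; rewrite leEsub. Qed.

Lemma moduleHomP T : linear (val T) /\ exists w : subsp W, hom_bound (val T) w.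
Proof. exact: (elimT (hom_predP D (val T)) (valP T)). Qed.

Lemma hom_norm_infimums T :
  infimums [set w | hom_bound (val T) w] (hom_norm T).
Proof.
have [_ [w Tw]] := moduleHomP T; rewrite /hom_norm /infimum.
case: eqP => [T0|_]; first by have : set0 w by rewrite -T0.
apply: xgetPex; apply: (cds_W D).2; first by exists w.
by exists 0 => t [].
Qed.

Lemma hom_norm_le T w : hom_bound (val T) w -> hom_norm T <= w.
Proof. by move=> Tw; have [lb _] := hom_norm_infimums T; exact: lb. Qed.

Lemma hom_norm_ge0 T : 0 <= hom_norm T.
Proof. by have [_ ub] := hom_norm_infimums T; apply: ub => w []. Qed.

Lemma hom_bound_meet (T : M -> N) (w1 w2 : subsp W) :
  hom_bound T w1 -> hom_bound T w2 -> hom_bound T (rmeet w1 w2).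
Proof.
move=> [w10 T1] [w20 T2]; split; first by rewrite le_rmeet w10.
by move=> v; rewrite -rmeetMr ?norm_ge0// le_rmeet T1 T2.
Qed.

(** The pairs [(|v|, w)], with [v] fixed and [w] a bound of [T], are directed
    downwards with infimum [(|v|, |T|)], and [|T v|] is a lower bound of their
    products. *)
Lemma hom_bound_norm T : hom_bound (val T) (hom_norm T).
Proof.
split=> [|v]; first exact: hom_norm_ge0.
pose P (X : solidSubspace A) (x : subsp X) (x0 : 0 <= x) : pos (subsp X) :=
  exist _ x x0.
pose pv := P _ _ (nm_ge0 (nm_normed M) v).
pose B : set (pos (subsp V) *p pos (subsp W)) :=
  [set p | p.1 = pv /\ hom_bound (val T) (val p.2)].
have B_down : down_directed B.
  split.
    by have [_ [w Tw]] := moduleHomP T; exists (pv, P _ w Tw.1); split.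
  move=> [_ w1] [_ w2] [/= -> Tw1] [/= -> Tw2].
  have Tw := hom_bound_meet Tw1 Tw2.
  exists (pv, P _ _ Tw.1); first by split.
  by split; rewrite leEprod lexx leEsub /=; [exact: rmeet_lel|exact: rmeet_ler].
have B_inf : infimums B (pv, P _ _ (hom_norm_ge0 T)).
  split=> [[a w] [/= -> Tw]|[a c] acB].
    by rewrite leEprod /= lexx leEsub; exact: hom_norm_le.
  rewrite leEprod !leEsub /=; apply/andP; split.
    have [_ [w Tw]] := moduleHomP T.
    have /acB : B (pv, P _ w Tw.1) by split.
    by rewrite leEprod leEsub => /andP[].
  have [_] := hom_norm_infimums T; apply => w Tw.
  have /acB : B (pv, P _ w Tw.1) by split.
  by rewrite leEprod !leEsub => /andP[].
have [_ _ /(_ B _ B_down B_inf)[_]] := cds_VW D.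
move=> /(_ (P _ _ (nm_ge0 normN (val T v)))).
rewrite !leEsub /= mulrC; apply => _ [[a w] [/= -> Tw] <-].
by rewrite !leEsub /= mulrC; exact: Tw.2.
Qed.

Lemma hom_norm_eq0 T : hom_norm T = 0 <-> T = 0.
Proof.
split=> [T0|->]; last first.
  apply/le_anti; rewrite hom_norm_ge0 andbT; apply: hom_norm_le.
  by split=> // v; rewrite (nm_norm0 normN) mul0r.
apply/val_inj/funext => v; apply/(nm_eq0 normN)/le_anti.
rewrite (nm_ge0 normN) andbT leEsub.
by have [_ /(_ v)] := hom_bound_norm T; rewrite T0 mul0r.
Qed.

Lemma hom_norm_triangle T S : hom_norm (T + S) <= hom_norm T + hom_norm S.
Proof.
apply: hom_norm_le; split.
  by apply: riesz_addr_ge0; exact: hom_norm_ge0.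
move=> v; rewrite [leRHS]mulrDl.
have := nm_triangle normN (val T v) (val S v); rewrite leEsub => /le_trans; apply.
by apply: riesz_leD; exact: (hom_bound_norm _).2.
Qed.

(** With [c = s / K] in the unit interval, [(1 - c) |T| + w / K] is a bound of
    [T], so [|T|] lies below it; this rearranges to the conclusion. *)
Lemma bounded_mul_hom_norm_le T (w : subsp W) (s : A) (K : R) :
  0 <= w -> solid_set U s -> 0 <= s -> 0 < K -> s <= K *: (1 : A) ->
  (forall v, s * val (nm_norm (val T v)) <= val w * val (nm_norm v)) ->
  s * val (hom_norm T) <= val w.
Proof.
move=> w0 Us s0 K0 sK Tw; set t := hom_norm T.
have Ki0 : 0 <= K^-1 by rewrite invr_ge0 ltW.
pose c := K^-1 *: to_subsp Us : subsp U.
have c0 : 0 <= val c by exact: riesz_scale_ge0.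
have c1 : 0 <= 1 - val c.
  rewrite riesz_subr_ge0.
  have -> : 1 = K^-1 *: (K *: (1 : A)) by rewrite scalerA mulVf ?gt_eqF ?scale1r.
  exact: riesz_ler_wpZ2l.
pose q := subsp_mul (mfs_closed (ds_W D)) (1 - c) t + K^-1 *: w.
have qE : val q = (1 - val c) * val t + K^-1 *: val w by [].
have Tq : hom_bound (val T) q.
  split.
    rewrite leEsub qE; apply: riesz_addr_ge0.
      by apply: fmul_ge0 => //; have := hom_norm_ge0 T; rewrite leEsub.
    by apply: riesz_scale_ge0 => //; rewrite leEsub in w0.
  move=> v; set y := val (nm_norm v); set x := val (nm_norm (val T v)).
  have -> : x = (1 - val c) * x + val c * x by rewrite -mulrDl subrK mul1r.
  rewrite qE [leRHS]mulrDl; apply: riesz_leD.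
    by rewrite -mulrA; apply: falg_ler_wpM2l => //; exact: (hom_bound_norm T).2.
  have -> : val c * x = K^-1 *: (s * x) by rewrite falg_scalerAl.
  by rewrite -falg_scalerAl; apply: riesz_ler_wpZ2l => //; exact: Tw.
have := hom_norm_le Tq; rewrite leEsub qE -/t mulrBl mul1r.
rewrite -riesz_subr_ge0 addrC !addrA addNr add0r addrC.
rewrite riesz_subr_ge0 -falg_scalerAl => /(riesz_ler_wpZ2l (ltW K0)).
by rewrite !scalerA mulfV ?gt_eqF// !scale1r.
Qed.

Lemma hom_norm_scale (u : subsp U) T :
  val (hom_norm (u *: T)) = (val (absr u) : A) * val (hom_norm T).
Proof.
have Tu v : val (nm_norm (val (u *: T) v)) =
    (val (absr u) : A) * val (nm_norm (val T v)).
  by rewrite -(nm_scale normN).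
have u0 : 0 <= (val (absr u) : A) by exact: (absr_ge0 u).
apply/le_anti/andP; split.
  pose w := subsp_mul (mfs_closed (ds_W D)) (absr u) (hom_norm T).
  suff /hom_norm_le : hom_bound (val (u *: T)) w by rewrite leEsub.
  split; first by rewrite leEsub; apply: fmul_ge0 => //; exact: hom_norm_ge0.
  move=> v; rewrite Tu -mulrA; apply: falg_ler_wpM2l => //.
  exact: (hom_bound_norm T).2.
have loc := mfs_localisable (ds_V D).
have [s [s_simple s_nd s_sup]] := loc_simple loc u0.
have s_le n : s n <= val (absr u) by apply: s_sup.1; exists n.
apply: (mul_le_of_sup loc _ s_nd s_sup) => [n||n].
- exact: (s_simple n).2.
- exact: hom_norm_ge0.
have [K K0 sK] := simple_le_scale1 (s_simple n).1.
have s0 := (s_simple n).2.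
apply: (bounded_mul_hom_norm_le (hom_norm_ge0 _) _ s0 K0 sK) => [|v].
  apply: (solid_solid (subspP (absr u))).
  by rewrite (ger0_absr u0) (ger0_absr s0).
apply: le_trans ((hom_bound_norm (u *: T)).2 v).
by rewrite Tu; apply: falg_ler_wpM2r => //; exact: norm_ge0.
Qed.

(** If [w] dominates all [|u_n T_n|], then [w |v|] dominates all [|u_n T_n v|],
    so [(T_n v)_n] can be glued in [N]; linearity and the bound [w] are then
    checked on each [u_n]. *)
Lemma hom_glueing (u : nat -> subsp U) (T : nat -> Hom) :
  Adm (hom_norm : Hom -> subsp W) u T -> exists S, is_glueing u T S.
Proof.
move=> [pu [[w wT] _]].
have {}wT n : hom_norm (u n *: T n) <= w by apply: wT; exists n.
have w0 : 0 <= w by apply: le_trans (wT 0%N); exact: hom_norm_ge0.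
have unT n v : val (nm_norm (u n *: val (T n) v)) <= val w * val (nm_norm v).
  apply: le_trans ((hom_bound_norm (u n *: T n)).2 v) _.
  apply: falg_ler_wpM2r; first exact: norm_ge0.
  by have := wT n; rewrite leEsub.
have /choice[F FP] v : exists y : N, is_glueing u (fun n => val (T n) v) y.
  apply: (nm_glueing normN); split=> //; split.
    exists (subsp_mul (mul_eq_closed (ds_mul D)) (nm_norm v) w).
    by move=> _ [n _ <-]; have := unT n v; rewrite mulrC.
  by exists 0 => _ [n _ <-]; exact: (nm_ge0 normN).
have linF : linear F.
  move=> b x y.
  apply: (glueing_unique normN pu (FP _)) => n.
  rewrite scalerDr scalerA mulrC -scalerA !FP.
  have [-> _] := moduleHomP (T n).
  by rewrite scalerDr !scalerA mulrC.
have bF : hom_bound F w.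
  split=> // v; apply: (nm_partition_le normN pu) => n.
  have [uI _ _] := pu.
  (* u_n is idempotent: one factor turns F into T_n, the other one remains
     in front of the bound. *)
  rewrite -[X in X *: _](uI n) expr2 -scalerA (nm_scale normN).
  rewrite ger0_absr ?leEsub; last exact: partition_ge0 pu.
  by apply: falg_ler_wpM2l; [exact: partition_ge0 pu|rewrite FP].
have FH : F \in hom_pred D by apply/hom_predP; split=> //; exists w.
exists (exist _ F FH) => n; apply/val_inj/funext => v.
exact: FP.
Qed.

Lemma hom_normed_module : is_normed_module (hom_norm : Hom -> subsp W).
Proof.
split.
- exact: hom_norm_ge0.
- exact: hom_norm_eq0.
- exact: hom_norm_triangle.
- exact: hom_norm_scale.
- exact: hom_glueing.
Qed.

End HomNorm.

(** * Completeness of the space of homomorphisms *)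

Section HomComplete.
Context {R : realType} {A : fAlgType R} {U : metricSolidFSub A}.
Context {V W Z : metricSolid A} (D : complete_dual_system U V W Z).
Context {M : normedModule U V} {N : normedModule U Z}.
Local Notation Hom := (moduleHom D M N).

Let normN := nm_normed N.
Let normH := @hom_normed_module R A U V W Z D M N.
Let metrU := mfa_riesz (mf_metric U).
Let metrV := ms_metric V.
Let metrW := ms_metric W.
Let metrZ := ms_metric Z.
Let mulVW := subsp_mul (mul_eq_closed (ds_mul D)).
Let mulUZ := subsp_mul (mfs_closed (ds_Z D)).

(** The defect of linearity of [F] is bounded by distances between [F] and
    [T_n] at three points, one of them multiplied by [|b|]; continuity of the
    product [U x Z -> Z] at [(|b|, 0)] makes that term small too. *)
Lemma linear_pointwise_limit (T : nat -> Hom) (F : M -> N) :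
  (forall v (e : R), 0 < e -> exists K, forall n, (K <= n)%N ->
    ms_dist (nm_norm (val (T n) v - F v)) 0 < e) ->
  linear F.
Proof.
move=> TF b x y; apply/eqP; rewrite -subr_eq0; apply/eqP/(nm_eq0 normN).
apply/le_anti; rewrite (nm_ge0 normN) andbT; apply: (mr_le0 metrZ) => e e0.
have e3 : 0 < e / 3 by rewrite divr_gt0.
have [del del0 bdel] := continuous2_mul0 (absr b) metrU metrZ
  (mfs_continuous (ds_Z D)) metrZ e3.
have [K1 T1] := TF (b *: x + y) _ e3.
have [K2 T2] := TF x _ del0.
have [K3 T3] := TF y _ e3.
pose n := maxn K1 (maxn K2 K3).
exists (nm_norm (F (b *: x + y) - val (T n) (b *: x + y)) +
  (mulUZ (absr b) (nm_norm (val (T n) x - F x)) +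
   nm_norm (val (T n) y - F y))).
  have [-> _] := moduleHomP (T n).
  have -> : F (b *: x + y) - (b *: F x + F y) =
      (F (b *: x + y) - (b *: val (T n) x + val (T n) y)) +
      (b *: (val (T n) x - F x) + (val (T n) y - F y)).
    by rewrite scalerBr [in RHS](addrACA (b *: _)) -opprD addrA subrK.
  apply: le_trans (nm_triangle normN _ _) _.
  apply: riesz_leD => //.
  apply: le_trans (nm_triangle normN _ _) _.
  apply: riesz_leD2r.
  by rewrite leEsub (nm_scale normN).
have -> : e = e / 3 + (e / 3 + e / 3) by field.
apply: le_lt_trans (mr_dist0D metrZ _ _) _; apply: ltrD.
  by rewrite (nm_normB normN); apply: T1; rewrite leq_maxl.
apply: le_lt_trans (mr_dist0D metrZ _ _) _; apply: ltrD.
  by apply: bdel; apply: T2; rewrite !leq_max leqnn orbT.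
by apply: T3; rewrite !leq_max leqnn !orbT.
Qed.

(** Passage to the limit in [|T_m v - S v| <= |T_m - S| |v|]: the error is at
    most [|T_m v - y| + |v| (|T_m - S| - w)], which is small by continuity of
    the product [V x W -> Z] at [(|v|, 0)]. *)
Lemma norm_sub_limit_le (T : nat -> Hom) (S : Hom) (w : subsp W) (v : M) (y : N) :
  (forall e : R, 0 < e -> exists K, forall m, (K <= m)%N ->
    ms_dist (hom_norm (T m - S)) w < e) ->
  (forall e : R, 0 < e -> exists K, forall m, (K <= m)%N ->
    ms_dist (nm_norm (val (T m) v - y)) 0 < e) ->
  val (nm_norm (y - val S v)) <= (val w : A) * val (nm_norm v).
Proof.
move=> Tw Ty.
suff : nm_norm (y - val S v) - mulVW (nm_norm v) w <= 0.
  by rewrite riesz_lerB add0r leEsub /= mulrC.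
apply: (mr_le0 metrZ) => e e0; have e2 : 0 < e / 2 by rewrite divr_gt0.
have [del del0 vdel] := continuous2_mul0 (nm_norm v) metrV metrW
  (ds_continuous D) metrZ e2.
have [K1 T1] := Ty _ e2.
have [K2 T2] := Tw _ del0.
pose m := maxn K1 K2.
exists (nm_norm (val (T m) v - y) +
    mulVW (nm_norm v) (hom_norm (T m - S) - w)).
  rewrite riesz_lerB -addrA.
  have -> : mulVW (nm_norm v) (hom_norm (T m - S) - w) + mulVW (nm_norm v) w =
      mulVW (nm_norm v) (hom_norm (T m - S)).
    by apply/val_inj; rewrite /= -mulrDr subrK.
  apply: le_trans (nm_normB_triangle normN _ (val (T m) v) _) _.
  rewrite (nm_normB normN); apply: riesz_leD => //.
  have := (hom_bound_norm (T m - S)).2 v.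
  by rewrite leEsub mulrC.
have -> : e = e / 2 + e / 2 by field.
apply: le_lt_trans (mr_dist0D metrZ _ _) _; apply: ltrD.
  by apply: T1; rewrite leq_maxl.
by apply: vdel; rewrite -(mr_distB metrW); apply: T2; rewrite leq_maxr.
Qed.

Lemma hom_complete :
  is_banach_module (nm_norm : N -> subsp Z) ->
  complete_dist (fun T S : Hom => ms_dist (hom_norm (T - S)) 0).
Proof.
move=> [_ completeN] T cauchyT.
have {}cauchyT e : 0 < e -> exists K, forall m n, (K <= m)%N -> (K <= n)%N ->
    ms_dist (hom_norm (T m - T n)) 0 < e.
  by move=> /cauchyT/near2_ooP.
have /choice[F FP] v : exists y, forall e : R, 0 < e ->
    exists K, forall n, (K <= n)%N -> ms_dist (nm_norm (val (T n) v - y)) 0 < e.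
  have [|y yP] := completeN (fun n => val (T n) v).
    move=> e e0; apply/near2_ooP.
    have [del del0 vdel] := continuous2_mul0 (nm_norm v) metrV metrW
      (ds_continuous D) metrZ e0.
    have [K KP] := cauchyT _ del0; exists K => m n Km Kn.
    apply: le_lt_trans (vdel _ (KP m n Km Kn)).
    apply: (mr_monotone metrZ); first exact: (nm_ge0 normN).
    by have := (hom_bound_norm (T m - T n)).2 v; rewrite leEsub mulrC.
  by exists y; apply/(cvg0_ooP (fun n => mr_dist_ge0 metrZ _ _)).
have /choice[w wP] n : exists w, forall e : R, 0 < e ->
    exists K, forall m, (K <= m)%N -> ms_dist (hom_norm (T m - T n)) w < e.
  have completeW := mr_complete metrW.
  have [|w wP] := completeW (fun m => hom_norm (T m - T n)).
    move=> e e0; apply/near2_ooP.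
    have [K KP] := cauchyT _ e0; exists K => m k Km Kk.
    apply: le_lt_trans (KP m k Km Kk); rewrite (mr_distB metrW).
    apply: (mr_dist_le metrW).
    have -> : T m - T k = (T m - T n) - (T k - T n).
      by rewrite opprB addrA subrK.
    exact: (nm_absB normH).
  by exists w; apply/(cvg0_ooP (fun n => mr_dist_ge0 metrW _ _)).
have Fw n v : val (nm_norm (F v - val (T n) v)) <= val (w n) * val (nm_norm v).
  exact: (norm_sub_limit_le (wP n) (FP v)).
(* w_n is a limit of positive elements. *)
have w0 n : 0 <= w n.
  rewrite -[w n]opprK -sub0r riesz_subr_ge0; apply: (mr_le0 metrW) => e e0.
  have [K KP] := wP n e e0; exists (hom_norm (T K - T n) - w n).
    by rewrite -[leLHS]add0r; apply: riesz_leD2r; exact: hom_norm_ge0.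
  by rewrite -(mr_distB metrW); exact: KP.
have linF := linear_pointwise_limit FP.
have FH : F \in hom_pred D.
  apply/hom_predP; split=> //; exists (w 0%N + hom_norm (T 0%N)); split.
    by apply: riesz_addr_ge0 => //; exact: hom_norm_ge0.
  move=> v; rewrite [leRHS]mulrDl.
  have := nm_triangle normN (F v - val (T 0%N) v) (val (T 0%N) v).
  rewrite subrK leEsub => /le_trans; apply; apply: riesz_leD; first exact: Fw.
  exact: (hom_bound_norm _).2.
pose S : Hom := exist _ F FH.
exists S; apply/(cvg0_ooP (fun n => mr_dist_ge0 metrW _ _)) => e e0.
have e2 : 0 < e / 2 by rewrite divr_gt0.
have [K KP] := cauchyT _ e2; exists K => n Kn.
have [L LP] := wP n _ e2; pose m := maxn K L.
have SFw : hom_norm (T n - S) <= w n.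
  by rewrite (nm_normB normH); apply: hom_norm_le; split=> // v; exact: Fw.
apply: le_lt_trans (mr_monotone metrW (hom_norm_ge0 _) SFw) _.
have [_ sym tri] := mr_distance metrW.
apply: le_lt_trans (tri _ (hom_norm (T m - T n)) _) _.
have -> : e = e / 2 + e / 2 by field.
apply: ltrD; first by rewrite sym; apply: LP; rewrite leq_maxr.
by apply: KP => //; rewrite leq_maxl.
Qed.

End HomComplete.

Theorem theorem3p12 (R : realType) (A : fAlgType R) (U : metricSolidFSub A)
    (V W Z : metricSolid A) (D : complete_dual_system U V W Z)
    (M : normedModule U V) (N : normedModule U Z) :
  [/\ (* |T v| <= |T| |v| *)
      forall (T : moduleHom D M N) (v : M),
        val (nm_norm (val T v)) <= (val (hom_norm T) : A) * val (nm_norm v),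
      is_normed_module (hom_norm : moduleHom D M N -> subsp W),
      (* the glueing of (|T_n|) in W exists, and is the norm of that of (T_n) *)
      forall (u : nat -> subsp U) (T : nat -> moduleHom D M N),
        Adm (hom_norm : moduleHom D M N -> subsp W) u T ->
        let normT : nat -> as_module (mfs_closed (ds_W D)) :=
          fun n => hom_norm (T n) in
        is_glueing u normT (module_glue u normT) /\
        hom_norm (module_glue u T) = module_glue u normT &
      is_banach_module (nm_norm : N -> subsp Z) ->
      is_banach_module (hom_norm : moduleHom D M N -> subsp W)].
Proof.
have normH := @hom_normed_module R A U V W Z D M N.
split=> [T v|//|u T adm normT|banachN].
- exact: (hom_bound_norm T).2.
- have pu := adm.1; have glueT := module_glueP normH adm.
  have u0 n : 0 <= u n by rewrite leEsub; exact: partition_ge0.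
  have gluehom : is_glueing u normT (hom_norm (module_glue u T)).
    move=> n; apply/val_inj; have /(congr1 hom_norm)/(congr1 val) := glueT n.
    by rewrite !hom_norm_scale ger0_absr.
  have glueW : is_glueing u normT (module_glue u normT).
    by apply: (xgetPex 0); exists (hom_norm (module_glue u T)).
  split=> //; apply/val_inj/le_anti/andP.
  by split; apply: (partition_le pu) => n;
    have /(congr1 val) := gluehom n; have /(congr1 val) := glueW n => /= -> ->.
- split=> //; exact: hom_complete.
Qed.
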